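(* Assume the setting and standing assumptions described in the context, and let $d>0$ be such that $\Xi\subset\Omega_d=\{z\in\mathbb{R}^{2n}:|z|<d\}$. Let $p\ge1$, $\epsilon>0$, and let $\delta_0,\dots,\delta_p\in\mathbb{R}$ satisfy: (1) $\mathcal{L}_F^p\phi(z)\le\sum_{i=0}^{p-1}\delta_i\mathcal{L}_F^i\phi(z)+\delta_p$ for all $z\in\Omega_d$; (2) $\delta_0\phi((x,0))+\delta_p\ge\epsilon$ for all $x\in\mathrm{Z}$; (3) $\delta_i\ge0$ for $i=0,\dots,p$. Let $r>0$ be such that $D=\{x\in\mathbb{R}^n:|x|=r\}\subset\mathrm{Z}$. Let $A$ be the $(p+1)\times(p+1)$ matrix with $A_{k,k+1}=1$ for $k=1,\dots,p-1$, $p$-th row $(\delta_0,\dots,\delta_{p-1},1)$, last row zero and all other entries zero; let $C=(1,0,\dots,0)$. For $x\in\mathbb{R}^n\setminus\{0\}$ and $t\ge0$ define $$\mu(x,t)=C\Big(\tfrac{|x|}{r}\Big)^{\theta+1}e^{A(\frac{|x|}{r})^{\alpha}t}\begin{bmatrix}\phi\big((r\tfrac{x}{|x|},0)\big)\\ \max\big(\mathcal{L}_F\phi((r\tfrac{x}{|x|},0)),0\big)\\ \vdots\\ \max\big(\mathcal{L}_F^{p-1}\phi((r\tfrac{x}{|x|},0)),0\big)\\ \delta_p\end{bmatrix}.$$ Then $\mu$ satisfies: (a) $\mu(x,0)<0$ for all $x\ne0$; (b) $\mu(x,t)\ge\phi(\xi(t;x))$ for all $t\in[0,\tau(x)]$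 and all $x\neq0$; (c) $\mu(\lambda x,t)=\lambda^{\theta+1}\mu(x,\lambda^\alpha t)$ for all $t,\lambda>0$, $x\ne0$; (d) for every $x\ne0$ there exists a unique $\tau_x$ with $\mu(x,\tau_x)=0$.
   Context: Let $f:\mathbb{R}^n\times\mathbb{R}^m\to\mathbb{R}^n$ and a feedback law $\upsilon:\mathbb{R}^n\to\mathbb{R}^m$ be given. Define $F:\mathbb{R}^{2n}\to\mathbb{R}^{2n}$ by $F(z,e)=\big(f(z,\upsilon(z+e)),\,-f(z,\upsilon(z+e))\big)$. For $x\in\mathbb{R}^n$, $\xi(t;x)$ denotes the solution of $\dot\xi=F(\xi)$ with $\xi(0;x)=(x,0)$. A triggering function $\phi:\mathbb{R}^{2n}\to\mathbb{R}$ is given, and $\tau(x)=\inf\{t>0:\phi(\xi(t;x))=0\}$. $\mathcal{L}_F^k\phi$ denotes the $k$-th Lie derivative of $\phi$ along $F$ ($\mathcal{L}_F^0\phi=\phi$). Standing assumptions: (i) $F$ is smooth and homogeneous of degree $\alpha\ge1$ with all weights $1$, i.e. $F(\lambda\xi)=\lambda^{\alpha+1}F(\xi)$ for all $\lambda>0$; (ii) $\phi$ is smooth and homogeneous of degree $\theta\ge1$ with weights $1$, i.e. $\phi(\lambda\xi)=\lambda^{\theta+1}\phi(\xi)$ for all $\lambda>0$; (iii) for every $x\ne0$, $\phi((x,0))<0$ and there exists $t_x\in(0,\infty)$ with $\phi(\xi(t_x;x))=0$; (iv) compact sets $\mathrm{Z}\subset\mathbb{R}^n$, $\Xi\subset\mathbb{R}^{2n}$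 containing a neighbourhood of the origin are given such that for all $x\in\mathrm{Z}$, $t\ge0$: $\phi(\xi(t;x))\le0\Rightarrow\xi(t;x)\in\Xi$; (v) the origin is the only equilibrium of $\dot\zeta=f(\zeta,\upsilon(\zeta))$. *)

(* Defs.v *)
From HB Require Import structures.
From mathcomp Require Import all_boot all_order all_algebra.
From mathcomp Require Import all_classical all_reals all_analysis.
Set Implicit Arguments. Unset Strict Implicit. Unset Printing Implicit Defensive.
Import Order.TTheory GRing.Theory Num.Theory.
Import numFieldNormedType.Exports.
Local Open Scope classical_set_scope.
Local Open Scope ring_scope.

Section Defs.
Variable R : realType.

Definition enorm (k : nat) (x : 'rV[R]_k) : R :=
  Num.sqrt (\sum_(i < k) x ord0 i ^+ 2).

Definition pair_st (n : nat) (z e : 'rV[R]_n) : 'rV[R]_(n + n) := row_mx z e.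

Definition Fcl (n m : nat) (f : 'rV[R]_n -> 'rV[R]_m -> 'rV[R]_n)
  (ups : 'rV[R]_n -> 'rV[R]_m) (w : 'rV[R]_(n + n)) : 'rV[R]_(n + n) :=
  let z := lsubmx w in let e := rsubmx w in
  row_mx (f z (ups (z + e))) (- f z (ups (z + e))).

Fixpoint iterD (V W : normedModType R) (vs : seq V) (g : V -> W) : V -> W :=
  match vs with
  | [::] => g
  | v :: vs' => fun x => 'D_v (iterD vs' g) x
  end.

Definition smooth (V W : normedModType R) (g : V -> W) : Prop :=
  forall (vs : seq V) (x : V), differentiable (iterD vs g) x.

(* homogeneity with all weights 1: g (lam x) = lam^(deg+1) g x, lam > 0 *)
Definition homogeneous (V W : normedModType R) (deg : R) (g : V -> W) : Prop :=
  forall (lam : R) (x : V), 0 < lam -> g (lam *: x) = (lam `^ (deg + 1)) *: g x.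

Fixpoint lie (V : normedModType R) (F : V -> V) (k : nat) (phi : V -> R) : V -> R :=
  match k with
  | 0 => phi
  | k'.+1 => fun z => 'D_(F z) (lie F k' phi) z
  end.

Definition expm (k : nat) (M : 'M[R]_k.+1) : 'M[R]_k.+1 :=
  \matrix_(i, j) limn (series (fun l : nat => (M ^+ l) i j / (l`!)%:R)).

Definition Amat (p : nat) (delta : nat -> R) : 'M[R]_p.+1 :=
  \matrix_(i, j)
    if (i.+1 < p)%N then (if j == i.+1 :> nat then 1 else 0)
    else if i == p.-1 :> nat then (if (j < p)%N then delta j else 1)
    else 0.

Definition Crow (p : nat) : 'rV[R]_p.+1 := \row_j (if j == 0 :> nat then 1 else 0).

Definition mu_vec (n p : nat) (F : 'rV[R]_(n + n) -> 'rV[R]_(n + n))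
  (phi : 'rV[R]_(n + n) -> R) (delta : nat -> R) (y : 'rV[R]_n) : 'cV[R]_p.+1 :=
  \col_i (if i == 0 :> nat then phi (pair_st y 0)
          else if (i < p)%N then Num.max (lie F i phi (pair_st y 0)) 0
          else delta p).

Definition mu (n p : nat) (F : 'rV[R]_(n + n) -> 'rV[R]_(n + n))
  (phi : 'rV[R]_(n + n) -> R) (delta : nat -> R) (alpha theta r : R)
  (x : 'rV[R]_n) (t : R) : R :=
  let s := enorm x / r in
  ((Crow p *m ((s `^ (theta + 1)) *: expm ((s `^ alpha * t) *: Amat p delta)))
     *m mu_vec p F phi delta (r / enorm x *: x)) ord0 ord0.

(* triggering time tau(x) = inf {t > 0 : phi(xi(t;x)) = 0}, where xi(.;x) is
   only considered on its interval of existence [0, T x) *)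
Definition trig_time (n : nat) (phi : 'rV[R]_(n + n) -> R)
  (xi : 'rV[R]_n -> R -> 'rV[R]_(n + n)) (T : 'rV[R]_n -> \bar R) (x : 'rV[R]_n) : R :=
  inf [set t : R | 0 < t /\ (t%:E < T x)%E /\ phi (xi x t) = 0].

End Defs.

(* Main.v *)
(** Along a trajectory starting on the sphere |x| = r the functions
    h_i = L_F^i phi form a chain h_i' = h_(i+1) closed by the differential
    inequality (1), while the components of the matrix exponential form the same
    chain with equality.  As the delta_i are nonnegative, the chain is a
    cooperative system, so differences of the two stay nonnegative: this is (b)
    on the sphere.  Homogeneity of F and uniqueness of solutions give
    xi(t; s y) = s xi(s^alpha t; y), which transports (b), and with it the
    triggering times, to all x <> 0.  For (d), the same comparison with the
    initial value shows that the last component of the chain grows at speed at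
    least eps; integrating p times, mu(x, .) is strictly increasing and
    unbounded. *)

Require Import Defs.
From HB Require Import structures.
From mathcomp Require Import all_boot all_order all_algebra.
From mathcomp Require Import all_classical all_reals all_analysis.
From mathcomp Require Import ring.
Import Order.TTheory GRing.Theory Num.Theory.
Import numFieldNormedType.Exports.
Local Open Scope classical_set_scope.
Local Open Scope ring_scope.

Set Implicit Arguments.
Unset Strict Implicit.

(** * Differential inequalities *)

Lemma is_derive_continuous (R : realType) (V : normedModType R) (g : R -> V)
  (t : R) (dg : V) : is_derive t 1 g dg -> {for t, continuous g}.
Proof.
by move=> [h _]; apply: differentiable_continuous; apply/derivable1_diffP.
Qed.

Lemma is_derive_within_continuous (R : realType) (V : normedModType R)
  (g dg : R -> V) (a b : R) :
  (forall t, a <= t <= b -> is_derive t 1 g (dg t)) ->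
  {within `[a, b], continuous g}.
Proof.
move=> h; apply: derivable_within_continuous => t; rewrite in_itv /= => tab.
by case: (h t tab).
Qed.

Lemma is_derive_ge0_le (R : realType) (g dg : R -> R) (a b : R) : a <= b ->
  (forall t, a <= t <= b -> is_derive t 1 g (dg t)) ->
  (forall t, a < t < b -> 0 <= dg t) -> g a <= g b.
Proof.
rewrite le_eqVlt => /orP[/eqP-> //|ab] h h0.
have [|c] := @MVT R g dg a b ab _ (is_derive_within_continuous h).
  by move=> t; rewrite in_itv /= => /andP[a1 b1]; apply: h; rewrite !ltW.
rewrite in_itv /= => cab e.
by rewrite -subr_ge0 e mulr_ge0 ?h0 // subr_ge0 ltW.
Qed.

Lemma is_derive_gt0_lt (R : realType) (g dg : R -> R) (a b : R) : a < b ->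
  (forall t, a <= t <= b -> is_derive t 1 g (dg t)) ->
  (forall t, a < t < b -> 0 < dg t) -> g a < g b.
Proof.
move=> ab h h0.
have [|c] := @MVT R g dg a b ab _ (is_derive_within_continuous h).
  by move=> t; rewrite in_itv /= => /andP[a1 b1]; apply: h; rewrite !ltW.
rewrite in_itv /= => cab e.
by rewrite -subr_gt0 e mulr_gt0 ?h0 // subr_gt0.
Qed.

Lemma is_derive_expR_scale (R : realType) (K t : R) :
  is_derive t 1 (fun u : R => expR (K * u)) (K * expR (K * t)).
Proof.
have h : is_derive t 1 ( *%R K) K.
  by apply: is_derive_eq; rewrite /GRing.scale /= mulr1.
by have := is_derive1_comp (is_derive_expR (K * t)) h; rewrite mulrC.
Qed.

(* At the first time where some component fails to be positive all components
   have been nondecreasing, hence are at least their initial values. *)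
Lemma cooperative_comparison_strict (R : realType) (p : nat) (b : R)
  (B : nat -> nat -> R) (w dw : nat -> R -> R) :
  (forall i j, (i < p)%N -> (j < p)%N -> 0 <= B i j) ->
  (forall i t, (i < p)%N -> 0 <= t <= b -> is_derive t 1 (w i) (dw i t)) ->
  (forall i t, (i < p)%N -> 0 <= t <= b ->
     \sum_(j < p) B i j * w j t <= dw i t) ->
  (forall i, (i < p)%N -> 0 < w i 0) ->
  forall i t, (i < p)%N -> 0 <= t <= b -> 0 < w i t.
Proof.
move=> B0 dwP dwB w0 i0 t0 i0p /andP[t0_ge0 t0b].
case: (ltP 0 (w i0 t0)) => // wi0.
pose S := [set t : R | 0 <= t <= b /\ exists2 i, (i < p)%N & w i t <= 0].
have S0 : S t0 by split; [rewrite t0_ge0 t0b | exists i0].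
have lbS : lbound S 0 by move=> t [/andP[]].
have infS : has_inf S by split; [exists t0 | exists 0].
pose s := inf S.
have s0 : 0 <= s by apply: lb_le_inf => //; exists t0.
have sb : s <= b by apply: le_trans t0b; apply: ge_inf => //; exists 0.
have pos i t : (i < p)%N -> 0 <= t < s -> 0 < w i t.
  move=> ip /andP[t_ge0 ts]; case: (ltP 0 (w i t)) => // wit.
  have : s <= t.
    apply: ge_inf; first by exists 0.
    by split; [rewrite t_ge0 (le_trans (ltW ts)) | exists i].
  by rewrite leNgt ts.
have poss i : (i < p)%N -> 0 < w i s.
  move=> ip; apply: (lt_le_trans (w0 i ip)).
  apply: (@is_derive_ge0_le R (w i) (dw i)) => // t /andP[t1 t2].
    by apply: dwP => //; rewrite t1 (le_trans t2).
  apply: (le_trans _ (dwB i t ip _)); last by rewrite !ltW// (lt_le_trans t2).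
  apply: sumr_ge0 => j _; apply: mulr_ge0; first exact: B0.
  by apply: ltW; apply: pos => //; rewrite ltW.
have near_pos (i : 'I_p) : \forall t \near s, 0 < w i t.
  have c : {for s, continuous (w i)}.
    by apply: (@is_derive_continuous _ _ _ _ (dw i s)); apply: dwP => //; rewrite s0.
  exact: (cvgr_gt _ c _ (poss i (ltn_ord i))).
(* All [w i] are positive on a common neighbourhood of [s], which contains a point of [S] because
   [s] is its infimum. *)
have /nbhs_ballP[e /= e0 he] := @filter_forall _ _ _ _ (nbhs_filter s) near_pos.
have [t [tb [i ip wit]] te] := inf_adherent e0 infS.
have st : s <= t by apply: ge_inf; [exists 0|split => //; exists i].
have := he t _ (Ordinal ip); rewrite /= ltNge wit => /(_ _)/= ff.
suff : false by [].
by apply: ff; rewrite /ball /= ler0_norm ?subr_le0 // opprB ltrBlDl.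
Qed.

(** Adding [de * expR (K * t)], with [K] at least every row sum of [B], makes the initial values
    strictly positive and preserves the differential inequality. The choice of [de] makes the
    perturbation equal to the arbitrary [e] at time [t]. *)
Lemma cooperative_comparison (R : realType) (p : nat) (b : R)
  (B : nat -> nat -> R) (w dw : nat -> R -> R) :
  (forall i j, (i < p)%N -> (j < p)%N -> 0 <= B i j) ->
  (forall i t, (i < p)%N -> 0 <= t <= b -> is_derive t 1 (w i) (dw i t)) ->
  (forall i t, (i < p)%N -> 0 <= t <= b ->
     \sum_(j < p) B i j * w j t <= dw i t) ->
  (forall i, (i < p)%N -> 0 <= w i 0) ->
  forall i t, (i < p)%N -> 0 <= t <= b -> 0 <= w i t.
Proof.
move=> B0 dwP dwB w0 i t ip tb.
pose K := \sum_(i < p) \sum_(j < p) B i j.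
apply/ler_addgt0Pr => e e0.
have d0 : 0 < e / expR (K * t) by rewrite divr_gt0 ?expR_gt0.
pose de := e / expR (K * t).
suff : 0 < w i t + de * expR (K * t)
  by rewrite /de divfK ?gt_eqF ?expR_gt0// => /ltW.
apply: (@cooperative_comparison_strict R p b B
  (fun i t => w i t + de * expR (K * t))
  (fun i t => dw i t + de * (K * expR (K * t)))) => //.
- move=> j u jp ub; have h1 := dwP j u jp ub.
  have h2 := is_derive_expR_scale K u.
  exact: is_deriveD h1 (is_deriveZ _ h2).
- move=> j u jp ub.
  under eq_bigr => l _ do rewrite mulrDr.
  rewrite big_split /= -mulr_suml lerD ?dwB // mulrCA.
  rewrite ler_wpM2l ?(ltW d0) // ler_wpM2r ?expR_ge0 // /K [leRHS](bigD1 (Ordinal jp)) //=.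
  by rewrite lerDl; apply: sumr_ge0 => l _; apply: sumr_ge0 => l' _; apply: B0.
- by move=> j jp; rewrite ltr_wpDl ?w0 // mulr_gt0 ?expR_gt0.
Qed.

(** * Matrix exponentials *)

Section ExponentialSeries.
Variables (R : realType) (a : nat -> R) (V M : R).
Hypotheses (M0 : 0 <= M) (aM : forall l, `|a l| <= V * M ^+ l).

(** Domination by [V] times the exponential series at M |K|. *)
Lemma is_cvg_pseries_fact (K : R) : cvgn (pseries (fun l => a l / l`!%:R) K).
Proof.
have V0 : 0 <= V by have := aM 0; rewrite expr0 mulr1; apply: le_trans.
have C := is_cvg_series_exp_coeff (M * `|K|).
apply: normed_cvg.
apply: (@series_le_cvg _ _ (fun l => V * exp_coeff (M * `|K|) l)).
- by move=> l /=.
- by move=> l; rewrite mulr_ge0 // exp_coeff_ge0 // mulr_ge0.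
- move=> l /=; rewrite !normrM /exp_coeff /= exprMn normrX normfV normr_nat.
  rewrite mulrAC !mulrA ler_wpM2r ?invr_ge0 ?ler0n //.
  by rewrite ler_wpM2r ?exprn_ge0.
- exact: (@is_cvg_seriesZ _ _ V C).
Qed.

End ExponentialSeries.

Lemma pseries_diffs_fact (R : realType) (a : nat -> R) :
  pseries_diffs (fun l => a l / l`!%:R) = (fun l => a l.+1 / l`!%:R).
Proof.
apply/funext => l; rewrite /pseries_diffs factS natrM invfM.
by rewrite mulrCA mulVKf // pnatr_eq0.
Qed.

(** Shifting [a] only multiplies [V] by [M] in the bound, so the series and its first two formal
    derivatives converge at |t| + 1, which justifies termwise differentiation. *)
Lemma is_derive_pseries_fact (R : realType) (a : nat -> R) (V M t : R) :
  0 <= M -> (forall l, `|a l| <= V * M ^+ l) ->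
  is_derive t 1 (fun u => limn (pseries (fun l => a l / l`!%:R) u))
    (limn (pseries (fun l => a l.+1 / l`!%:R) t)).
Proof.
move=> M0 aM.
have aM1 l : `|a l.+1| <= V * M * M ^+ l by rewrite -mulrA -exprS.
have aM2 l : `|a l.+2| <= V * M * M * M ^+ l by rewrite -!mulrA -!exprS.
rewrite -pseries_diffs_fact.
apply: (@pseries_snd_diffs _ _ (`|t| + 1)).
- exact: (is_cvg_pseries_fact M0 aM).
- by rewrite pseries_diffs_fact; exact: (is_cvg_pseries_fact M0 aM1).
- by rewrite !pseries_diffs_fact;
    exact: (is_cvg_pseries_fact M0 aM2).
- by rewrite [ltRHS]ger0_norm ?addr_ge0 // ltrDl.
Qed.

Section MatrixExponential.
Variables (R : realType) (k : nat) (A : 'M[R]_k.+1).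

Let M := \sum_i \sum_j `|A i j|.

Let M_ge0 : 0 <= M.
Proof. by apply: sumr_ge0 => i _; apply: sumr_ge0. Qed.

(** In the sum for A^(l+1) = A^l A, each |A h j| is at most the absolute sum of row [h], and these
    row sums add up to [M]. *)
Lemma norm_mx_expr_le l i j : `|(A ^+ l) i j| <= M ^+ l.
Proof.
elim: l i j => [|l ih] i j.
  by rewrite !expr0 mxE; case: (_ == _); rewrite ?normr1 ?normr0.
rewrite exprSr -mulmxE mxE; apply: (le_trans (ler_norm_sum _ _ _)).
rewrite exprSr /M mulr_sumr; apply: ler_sum => h _.
rewrite normrM ler_pM //.
by rewrite (bigD1 j) //= lerDl sumr_ge0.
Qed.

Lemma norm_mx_expr_mul_le (v : 'cV[R]_k.+1) l i :
  `|(A ^+ l *m v) i ord0| <= (\sum_j `|v j ord0|) * M ^+ l.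
Proof.
rewrite mxE; apply: (le_trans (ler_norm_sum _ _ _)); rewrite mulr_suml.
apply: ler_sum => h _; rewrite normrM mulrC ler_wpM2l //.
exact: norm_mx_expr_le.
Qed.

(** Exchanging the finite sum over columns with the limit leaves a scalar power series in [t], to
    which the termwise results apply. *)
Lemma expm_mulE (v : 'cV[R]_k.+1) (t : R) i :
  (expm (t *: A) *m v) i ord0 =
  limn (pseries (fun l => (A ^+ l *m v) i ord0 / l`!%:R) t).
Proof.
apply/esym/cvg_lim => //.
have -> : pseries (fun l => (A ^+ l *m v) i ord0 / l`!%:R) t =
    fun N => \sum_j series (fun l => ((t *: A) ^+ l) i j / l`!%:R) N * v j ord0.
  apply/funext => N; rewrite /pseries /series /=.
  rewrite (eq_bigr (fun j => \sum_(0 <= l < N)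
     ((t *: A) ^+ l) i j / l`!%:R * v j ord0)); last first.
    by move=> j _; rewrite mulr_suml.
  rewrite exchange_big /=; apply: eq_bigr => l _.
  rewrite mxE !mulr_suml; apply: eq_bigr => j _.
  by rewrite exprZn mxE; ring.
rewrite mxE; apply: cvg_big => [|j _]; first exact: add_continuous.
rewrite mxE; apply: cvgMr_tmp.
have -> : (fun l => ((t *: A) ^+ l) i j / l`!%:R) =
   (fun l => (A ^+ l) i j / l`!%:R * t ^+ l).
  by apply/funext => l; rewrite exprZn mxE; ring.
have h l : `|(A ^+ l) i j| <= 1 * M ^+ l by rewrite mul1r norm_mx_expr_le.
exact: (is_cvg_pseries_fact M_ge0 h).
Qed.

(** Differentiation shifts the coefficients, and A^(l+1) v = A (A^l v): this is the linear system u'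
    = A u. *)
Lemma is_derive_expm_mul (v : 'cV[R]_k.+1) (t : R) i :
  is_derive t 1 (fun u => (expm (u *: A) *m v) i ord0)
    (\sum_j A i j * (expm (t *: A) *m v) j ord0).
Proof.
have -> : (fun u => (expm (u *: A) *m v) i ord0) =
    fun u => limn (pseries (fun l => (A ^+ l *m v) i ord0 / l`!%:R) u).
  by apply/funext => u; rewrite expm_mulE.
apply: is_derive_eq (is_derive_pseries_fact t M_ge0 (fun l =>
  norm_mx_expr_mul_le v l i)) _.
apply/cvg_lim => //.
have -> : pseries (fun l => (A ^+ l.+1 *m v) i ord0 / l`!%:R) t =
    fun N => \sum_j A i j *
      pseries (fun l => (A ^+ l *m v) j ord0 / l`!%:R) t N.
  apply/funext => N; rewrite /pseries /series /=.
  under [RHS]eq_bigr => j _ do rewrite mulr_sumr.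
  rewrite exchange_big /=; apply: eq_bigr => l _.
  rewrite exprS -mulmxE -mulmxA mxE !mulr_suml; apply: eq_bigr => j _.
  by rewrite !mulrA.
apply: cvg_big => [|j _]; first exact: add_continuous.
rewrite expm_mulE; apply: cvgMl_tmp.
exact: (is_cvg_pseries_fact M_ge0 (fun l => norm_mx_expr_mul_le v l j)).
Qed.

Lemma expm0_mul (v : 'cV[R]_k.+1) : expm (0 *: A) *m v = v.
Proof.
apply/colP => i; rewrite expm_mulE; apply/cvg_lim => //.
(* The shift drops the empty partial sum; all others equal the term l = 0. *)
rewrite -(cvg_shiftS _) (_ : (fun n => _) = cst (v i ord0)); first exact: cvg_cst.
apply/funext => N; rewrite /pseries /series /= big_nat_recl // expr0 mul1mx.
rewrite big1 ?addr0; last by move=> l _; rewrite expr0n mulr0.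
by rewrite fact0 divr1 expr0 mulr1.
Qed.
End MatrixExponential.

(** * Smooth functions and Lie derivatives *)

(** If u' = F(u) and [g] is a Lie derivative of [phi] along F, the derivative obtained is by
    definition the next Lie derivative at [u t]. *)
Lemma is_derive_comp_diff (R : realType) (V W : normedModType R) (g : V -> W)
  (u : R -> V) (t : R) (du : V) :
  differentiable g (u t) -> is_derive t 1 u du ->
  is_derive t 1 (g \o u) ('D_du g (u t)).
Proof.
move=> dg [/derivable1_diffP ut <-].
have dgu : differentiable (g \o u) t by apply: differentiable_comp.
apply: DeriveDef; first exact/derivable1_diffP.
by rewrite !deriveE // diff_comp.
Qed.

Lemma is_derive_coord (R : realType) (n : nat) (u : R -> 'rV[R]_n)
  (t : R) (du : 'rV[R]_n) (i : 'I_n) :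
  is_derive t 1 u du -> is_derive t 1 (fun s => u s ord0 i) (du ord0 i).
Proof.
move=> [ut <-]; have h := (@derivable_mxP _ _ _ _ _ _ _).1 ut ord0 i.
by apply: DeriveDef => //; rewrite (derive_mx ut) mxE.
Qed.

Local Notation iterD := Defs.iterD.

Section Smooth.
Variables (R : realType) (V : normedModType R).

(** A finite order allows induction for products: the derivative of a product is a sum of products
    of one order less. *)
Definition smooth_upto (W : normedModType R) (k : nat) (g : V -> W) :=
  forall vs : seq V, (size vs <= k)%N ->
    forall x, differentiable (iterD vs g) x.

Lemma smoothP (W : normedModType R) (g : V -> W) :
  smooth g <-> forall k, smooth_upto k g.
Proof. by split=> [sg k vs _ x|sg vs x]; [exact: sg|exact: (sg (size vs))]. Qed.

Lemma smooth_upto_le (W : normedModType R) (k l : nat) (g : V -> W) :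
  (k <= l)%N -> smooth_upto l g -> smooth_upto k g.
Proof. by move=> kl sg vs vk; apply: sg; apply: leq_trans kl. Qed.

(** The head of the list is the outermost derivative; peeling off the innermost one replaces [g] by
    its derivative. *)
Lemma iterD_rcons (W : normedModType R) (vs : seq V) (v : V) (g : V -> W) :
  iterD (rcons vs v) g = iterD vs (fun x => 'D_v g x).
Proof. by elim: vs => [|u vs ih] //=; rewrite ih. Qed.

Lemma smooth_differentiable (W : normedModType R) (g : V -> W) x :
  smooth g -> differentiable g x.
Proof. by move=> sg; have := sg [::] x. Qed.

Lemma smooth_upto_derive (W : normedModType R) (k : nat) (g : V -> W) v :
  smooth_upto k.+1 g -> smooth_upto k (fun x => 'D_v g x).
Proof. by move=> sg vs vk; rewrite -iterD_rcons; apply: sg; rewrite size_rcons. Qed.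

Lemma smooth_derive (W : normedModType R) (g : V -> W) v :
  smooth g -> smooth (fun x => 'D_v g x).
Proof. by move=> sg vs x; rewrite -iterD_rcons. Qed.

Lemma iterD_add (W : normedModType R) (k : nat) (f g : V -> W) vs :
  smooth_upto k f -> smooth_upto k g -> (size vs <= k)%N ->
  iterD vs (f + g) = iterD vs f + iterD vs g.
Proof.
move=> sf sg; elim: vs => [//|v vs ih] vk; apply/funext => x /=.
by rewrite ih 1?ltnW // deriveD //; apply: diff_derivable;
  [apply: sf|apply: sg]; rewrite ltnW.
Qed.

Lemma smooth_upto_add (W : normedModType R) (k : nat) (f g : V -> W) :
  smooth_upto k f -> smooth_upto k g -> smooth_upto k (f + g).
Proof.
by move=> sf sg vs vk x; rewrite (iterD_add sf sg) //; apply: differentiableD;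
  [apply: sf|apply: sg].
Qed.

Lemma iterD_cst0 (W : normedModType R) (vs : seq V) :
  iterD vs (fun _ => 0 : W) = fun _ => 0.
Proof.
by elim: vs => [//|v vs ih]; apply/funext => x /=; rewrite ih derive_cst.
Qed.

Lemma smooth_sum (W : normedModType R) (n : nat) (f : 'I_n -> V -> W) :
  (forall i, smooth (f i)) -> smooth (fun x => \sum_(i < n) f i x).
Proof.
elim: n f => [|n ih] f sf.
  have -> : (fun x => \sum_(i < 0) f i x) = fun _ => 0.
    by apply/funext => x; rewrite big_ord0.
  by move=> vs x; rewrite iterD_cst0.
have -> : (fun x => \sum_(i < n.+1) f i x) =
    (fun x => \sum_(i < n) f (widen_ord (leqnSn n) i) x) + f ord_max.
  by apply/funext => x; rewrite big_ord_recr.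
by apply/smoothP => k; apply: smooth_upto_add; apply: (smoothP _).1; auto.
Qed.

Lemma smooth_upto_mul (k : nat) (f g : V -> R) :
  smooth_upto k f -> smooth_upto k g -> smooth_upto k (fun x => f x * g x).
Proof.
elim: k f g => [|k ih] f g sf sg.
  by case=> // _ x; apply: differentiableM; [apply: (sf [::])|apply: (sg [::])].
elim/last_ind => [_ x|vs v _].
  by apply: differentiableM; [apply: (sf [::])|apply: (sg [::])].
rewrite size_rcons iterD_rcons => vk.
have -> : (fun x => 'D_v (fun y => f y * g y) x) =
    (fun x => f x * 'D_v g x) + (fun x => g x * 'D_v f x).
  apply/funext => y.
  by rewrite deriveM //; apply: diff_derivable; [apply: (sf [::])|apply: (sg [::])].
apply: (@smooth_upto_add _ k) => //; apply: ih.
- exact: smooth_upto_le sf.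
- exact: smooth_upto_derive.
- exact: smooth_upto_le sg.
- exact: smooth_upto_derive.
Qed.

Lemma smooth_mul (f g : V -> R) :
  smooth f -> smooth g -> smooth (fun x => f x * g x).
Proof.
by move=> sf sg; apply/smoothP => k; apply: smooth_upto_mul; apply: (smoothP _).1.
Qed.

Lemma smooth_coord (m n : nat) (F : V -> 'M[R]_(m, n)) i j :
  smooth F -> smooth (fun x => F x i j).
Proof.
move=> sF vs.
have -> : iterD vs (fun x => F x i j) = fun x => iterD vs F x i j.
  elim: vs => [//|v vs ih]; apply/funext => x /=.
  by rewrite ih derive_mx ?mxE //; apply: diff_derivable.
move=> x; apply: (@differentiable_comp _ _ _ _ (iterD vs F) (fun M => M i j)) => //.
exact: differentiable_coord.
Qed.

End Smooth.

Lemma derive_sum_coord (R : realType) (n : nat) (g : 'rV[R]_n -> R) x v :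
  differentiable g x ->
  'D_v g x = \sum_(j < n) v ord0 j * 'D_(delta_mx ord0 j) g x.
Proof.
move=> dg; rewrite deriveE // [in LHS](row_sum_delta v) linear_sum.
by apply: eq_bigr => j _; rewrite linearZ deriveE.
Qed.

(** The direction [F z] varies with [z], while [smooth] concerns fixed directions. Expanding in the
    standard basis leaves products of coordinates of [F] with fixed-direction derivatives. *)
Lemma smooth_lie (R : realType) (n : nat) (F : 'rV[R]_n -> 'rV[R]_n)
  (phi : 'rV[R]_n -> R) k : smooth F -> smooth phi -> smooth (lie F k phi).
Proof.
move=> sF sphi; elim: k => [//|k ih] /=.
have -> : (fun z => 'D_(F z) (lie F k phi) z) =
    fun z => \sum_(j < n) F z ord0 j * 'D_(delta_mx ord0 j) (lie F k phi) z.
  by apply/funext => z; rewrite derive_sum_coord //; apply: smooth_differentiable.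
apply: smooth_sum => j; apply: smooth_mul; first exact: smooth_coord.
exact: smooth_derive.
Qed.

(** * Uniqueness of solutions *)

Lemma compact_norm_ball (R : realType) (n : nat) (B : R) :
  compact [set z : 'rV[R]_n | `|z| <= B].
Proof.
apply: bounded_closed_compact.
  by exists B; split => [|M BM z /= zB]; [exact: num_real|rewrite (le_trans zB) ?ltW].
have -> : [set z : 'rV[R]_n | `|z| <= B] = Num.norm @^-1` [set y : R | y <= B] by [].
by apply: preimage_closed; [move=> z _; exact: norm_continuous|exact: closed_le].
Qed.

Lemma continuous_sum_ord (R : realType) (T : topologicalType) (n : nat)
  (f : 'I_n -> T -> R) :
  (forall i, continuous (f i)) -> continuous (fun z => \sum_(i < n) f i z).
Proof.
by move=> cf z; apply: cvg_big => [|i _]; [exact: add_continuous|exact: cf].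
Qed.

(** Mean value theorem on the segment from [b] to [a], which stays in the convex ball; [L] is the
    maximum over the compact ball of the sum of all absolute partial derivatives. *)
Lemma smooth_lipschitz_ball (R : realType) (n m : nat)
  (F : 'rV[R]_n -> 'rV[R]_m) (B : R) : smooth F ->
  exists2 L, 0 <= L & forall a b i, `|a| <= B -> `|b| <= B ->
    `|F a ord0 i - F b ord0 i| <= L * \sum_j `|(a - b) ord0 j|.
Proof.
move=> sF.
pose P i j z := 'D_(delta_mx ord0 j) (fun y => F y ord0 i) z : R.
have [B0|B0] := ltP B 0.
  exists 0 => // a b i aB; have := le_lt_trans aB B0.
  by rewrite normr_lt0.
have ball0 : [set z : 'rV[R]_n | `|z| <= B] !=set0 by exists 0; rewrite /= normr0.
have cP : continuous (fun z => \sum_(i < m) \sum_(j < n) `|P i j z|).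
  apply: continuous_sum_ord => i; apply: continuous_sum_ord => j z.
  apply: continuous_comp; last exact: norm_continuous.
  apply: differentiable_continuous.
  by apply: smooth_differentiable; apply: smooth_derive; apply: smooth_coord.
have [c _ hc] := EVT_max_rV ball0 (@compact_norm_ball R n B)
  (continuous_subspaceT cP).
set L := \sum_(i < m) _ in hc.
exists L; first by apply: sumr_ge0 => i _; apply: sumr_ge0.
move=> a b i aB bB.
pose h (s : R) := F (b + s *: (a - b)) ord0 i.
pose dh (s : R) := 'D_(a - b) (fun y => F y ord0 i) (b + s *: (a - b)).
have dF z : differentiable (fun y => F y ord0 i) z.
  by apply: smooth_differentiable; apply: smooth_coord.
have hdh (s : R) : is_derive s 1 h (dh s).
  apply: (@is_derive_comp_diff _ _ _ _ (fun s => b + s *: (a - b))) => //.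
  have h1 : is_derive s 1 (fun s : R => s *: (a - b)) (a - b).
    apply: DeriveDef; first exact/derivable1_diffP.
    by rewrite deriveE // diff_val scale1r.
  have := is_deriveD (is_derive_cst b s 1) h1; by rewrite add0r.
have [c0 c01] := @MVT_segment R h dh 0 1 ler01 (fun x _ => hdh x)
  (@is_derive_within_continuous _ _ _ _ _ _ (fun t _ => hdh t)).
rewrite /h scale0r addr0 scale1r subr0 mulr1 (addrC b) subrK => ->.
rewrite /dh derive_sum_coord // mulr_sumr.
apply: (le_trans (ler_norm_sum _ _ _)); apply: ler_sum => j _.
rewrite normrM mulrC ler_wpM2r //.
apply: le_trans (hc (b + c0 *: (a - b)) _); last first.
  move: c01; rewrite in_itv /= => /andP[c00 c01].
  rewrite inE /= (_ : b + _ = (1 - c0) *: b + c0 *: a); last first.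
    by rewrite scalerBl scale1r scalerBr addrAC addrA.
  apply: (le_trans (ler_normD _ _)); rewrite !normrZ.
  rewrite (ger0_norm c00) ger0_norm ?subr_ge0 //.
  have -> : B = (1 - c0) * B + c0 * B by ring.
  by rewrite lerD // ler_wpM2l // subr_ge0.
rewrite (bigD1 i) //= (bigD1 j) //= -addrA lerDl.
by rewrite addr_ge0 // sumr_ge0 // => *; rewrite sumr_ge0.
Qed.

(** Confines solutions on a compact time interval to a ball, where a Lipschitz constant is
    available. *)
Lemma is_derive_norm_bounded (R : realType) (V : normedModType R)
  (u du : R -> V) (b : R) : 0 <= b ->
  (forall t, 0 <= t <= b -> is_derive t 1 u (du t)) ->
  exists B, forall t, 0 <= t <= b -> `|u t| <= B.
Proof.
move=> b0 h.
have c : {within `[0, b], continuous (fun t => `|u t|)}.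
  move=> t; apply: cvg_norm; exact: (is_derive_within_continuous h).
have [s _ hs] := EVT_max b0 c.
by exists `|u s| => t tb; apply: hs; rewrite in_itv.
Qed.

(* Gronwall's inequality for the squared distance of the two solutions. *)
Lemma ode_unique (R : realType) (n : nat) (F : 'rV[R]_n -> 'rV[R]_n)
  (u v : R -> 'rV[R]_n) (b : R) : smooth F -> 0 <= b -> u 0 = v 0 ->
  (forall t, 0 <= t <= b -> is_derive t 1 u (F (u t))) ->
  (forall t, 0 <= t <= b -> is_derive t 1 v (F (v t))) -> u b = v b.
Proof.
move=> sF b0 uv0 hu hv.
have [Bu hBu] := is_derive_norm_bounded b0 hu.
have [Bv hBv] := is_derive_norm_bounded b0 hv.
have [L L0 hL] := smooth_lipschitz_ball (Num.max Bu Bv) sF.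
pose w i t := u t ord0 i - v t ord0 i.
pose dw i t := F (u t) ord0 i - F (v t) ord0 i.
pose g t := \sum_(i < n) w i t ^+ 2.
pose dg t := \sum_(i < n) 2 * w i t * dw i t.
(* From 2 |w_i| |w_j| <= w_i^2 + w_j^2, summed over all pairs and multiplied by [L]. *)
pose K := 2 * L * n%:R.
have g_ge0 t : 0 <= g t by apply: sumr_ge0 => i _; rewrite sqr_ge0.
have hw i t : 0 <= t <= b -> is_derive t 1 (w i) (dw i t).
  by move=> tb; apply: is_deriveB; apply: is_derive_coord; auto.
have hg t : 0 <= t <= b -> is_derive t 1 g (dg t).
  move=> tb.
  have -> : g = \sum_(i < n) (fun t => w i t ^+ 2).
    by apply/funext => s; rewrite fct_sumE.
  apply: is_derive_sum => i.
  apply: is_derive_eq (is_deriveM (hw i t tb) (hw i t tb)) _.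
  by rewrite /GRing.scale /=; ring.
have dg_le t : 0 <= t <= b -> dg t <= K * g t.
  move=> tb.
  have -> : K * g t = \sum_(i < n) \sum_(j < n) L * (w i t ^+ 2 + w j t ^+ 2).
    rewrite (eq_bigr (fun i => L * (n%:R * w i t ^+ 2 + g t))); last first.
      move=> i _; rewrite -mulr_sumr big_split /= sumr_const card_ord.
      by rewrite mulr_natl.
    rewrite -mulr_sumr big_split /= -mulr_sumr sumr_const card_ord -/(g t).
    by rewrite /K -[g t *+ n]mulr_natl; ring.
  apply: ler_sum => i _.
  apply: (le_trans (ler_norm _)); rewrite !normrM ger0_norm //.
  have := hL (u t) (v t) i.
  rewrite !le_max hBu // hBv // orbT => /(_ isT isT) hLi.
  apply: (@le_trans _ _ (2 * `|w i t| * (L * \sum_j `|(u t - v t) ord0 j|))).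
    by rewrite ler_wpM2l // mulr_ge0.
  rewrite mulrCA -mulr_sumr ler_wpM2l // mulr_sumr; apply: ler_sum => j _.
  rewrite !mxE -/(w j t) -[w i t ^+ 2]real_normK ?num_real//.
  rewrite -[w j t ^+ 2]real_normK ?num_real//.
  by rewrite -subr_ge0 (_ : _ - _ = (`|w i t| - `|w j t|) ^+ 2) ?sqr_ge0 //; ring.
(* With the integrating factor exp(-K t), [g] becomes nonincreasing; it starts at 0. *)
have : - (g 0 * expR (- K * 0)) <= - (g b * expR (- K * b)).
  apply: (@is_derive_ge0_le R (fun t => - (g t * expR (- K * t)))
    (fun t => - (g t * (- K * expR (- K * t)) + expR (- K * t) * dg t))) => // t tb.
    exact: is_deriveN (is_deriveM (hg t tb) (is_derive_expR_scale (- K) t)).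
  have tb' : 0 <= t <= b by case/andP: tb => *; rewrite !ltW.
  rewrite (_ : - _ = expR (- K * t) * (K * g t - dg t)); last by ring.
  by rewrite mulr_ge0 ?expR_ge0 // subr_ge0 dg_le.
have -> : g 0 = 0.
  by rewrite /g big1 // => i _; rewrite /w uv0 subrr expr0n.
rewrite mul0r lerN2 => gb.
have {}gb : g b <= 0 by rewrite -(@pmulr_lle0 _ (expR (- K * b))) ?expR_gt0.
apply/rowP => i; apply/eqP; rewrite -subr_eq0 -sqrf_eq0 -/(w i b).
rewrite eq_le sqr_ge0 andbT; apply: le_trans gb.
by rewrite /g (bigD1 i) //= lerDl sumr_ge0 // => j _; rewrite sqr_ge0.
Qed.

(** * Chains of differential inequalities *)

(** One integration of a power lower bound, by monotonicity of [g] minus the primitive of the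
    power. *)
Lemma is_derive_pow_le (R : realType) (g dg : R -> R) (C : R) (k : nat) :
  (forall t : R, 0 <= t -> is_derive t 1 g (dg t)) ->
  (forall t : R, 0 <= t -> C * t ^+ k <= dg t) ->
  forall t : R, 0 <= t -> g 0 + C / k.+1%:R * t ^+ k.+1 <= g t.
Proof.
move=> hg hC t t0.
have : g 0 - C / k.+1%:R * 0 ^+ k.+1 <= g t - C / k.+1%:R * t ^+ k.+1.
  apply: (@is_derive_ge0_le R (fun s => g s - C / k.+1%:R * s ^+ k.+1)
    (fun s => dg s - C * s ^+ k)) => // s /andP[s0 _].
    apply: is_deriveB; first exact: hg.
    have h : is_derive s 1 (fun s : R => s ^+ k.+1) (k.+1%:R * s ^+ k).
      apply: DeriveDef; first exact: exprn_derivable.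
      by rewrite exp_derive /GRing.scale /= mulr1.
    apply: is_derive_eq (is_deriveZ (C / k.+1%:R) h) _.
    by rewrite /GRing.scale /= mulrA divfK // pnatr_eq0.
  by rewrite subr_ge0 hC // ltW.
by rewrite expr0n /= mulr0 subr0 lerBrDr.
Qed.

Section Chain.
Variables (R : realType) (p : nat) (delta : nat -> R).

(** Companion matrix of the chain: ones above the diagonal, the [delta j] in the last row. *)
Let B (i j : nat) : R := if (i.+1 < p)%N then (j == i.+1)%:R else delta j.

Let sum_B i (x : nat -> R) : \sum_(j < p) B i j * x j =
  if (i.+1 < p)%N then x i.+1 else \sum_(j < p) delta j * x j.
Proof.
rewrite /B; case: ifP => ip //; rewrite (bigD1 (Ordinal ip)) //= eqxx mul1r.
rewrite big1 ?addr0 // => j; rewrite -val_eqE /= => /negbTE ->.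
by rewrite mul0r.
Qed.

Hypothesis delta_ge0 : forall i, (i < p)%N -> 0 <= delta i.

Lemma chain_comparison (b : R) (w dw : nat -> R -> R) :
  (forall i t, (i < p)%N -> 0 <= t <= b -> is_derive t 1 (w i) (dw i t)) ->
  (forall i t, (i < p)%N -> 0 <= t <= b ->
     (if (i.+1 < p)%N then w i.+1 t else \sum_(j < p) delta j * w j t)
       <= dw i t) ->
  (forall i, (i < p)%N -> 0 <= w i 0) ->
  forall i t, (i < p)%N -> 0 <= t <= b -> 0 <= w i t.
Proof.
move=> hw hdw w0; apply: (@cooperative_comparison R p b B w dw) => //.
  by move=> i j _ jp; rewrite /B; case: ifP => _; rewrite ?ler0n ?delta_ge0.
by move=> i t ip tb; rewrite (sum_B i (w ^~ t)); apply: hdw.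
Qed.

Variables (c : R) (psi : nat -> R -> R).

(** Right-hand side of the chain with equality; the constant [c] stands for the constant last state
    of the exponential system. *)
Let dpsi i t :=
  if (i.+1 < p)%N then psi i.+1 t else \sum_(j < p) delta j * psi j t + c.

Hypothesis psiP : forall i (t : R), (i < p)%N -> is_derive t 1 (psi i) (dpsi i t).

Lemma lie_le_chain (n : nat) (F : 'rV[R]_n -> 'rV[R]_n) (phi : 'rV[R]_n -> R)
  (u : R -> 'rV[R]_n) (b : R) : smooth F -> smooth phi -> (0 < p)%N -> 0 <= b ->
  (forall t, 0 <= t <= b -> is_derive t 1 u (F (u t))) ->
  (forall t, 0 <= t <= b -> lie F p phi (u t) <=
     \sum_(i < p) delta i * lie F i phi (u t) + c) ->
  (forall i, (i < p)%N -> lie F i phi (u 0) <= psi i 0) ->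
  phi (u b) <= psi 0%N b.
Proof.
move=> sF sphi p0 b0 hu hlie h0; rewrite -subr_ge0.
apply: (@chain_comparison b (fun i t => psi i t - lie F i phi (u t))
  (fun i t => dpsi i t - lie F i.+1 phi (u t))) => //; last 2 first.
- by move=> i ip; rewrite subr_ge0 h0.
- by rewrite b0 lexx.
- move=> i t ip tb; apply: is_deriveB; first exact: psiP.
  apply: (@is_derive_comp_diff _ _ _ (lie F i phi) u); last exact: hu.
  by apply: smooth_differentiable; apply: smooth_lie.
(* Only the last row is an inequality: there the constants [c] cancel against the bound on the Lie
   derivative of order [p]. *)
- move=> i t ip tb; rewrite /dpsi; case: ifP => // ip'.
  have -> : i.+1 = p by apply/eqP; rewrite eqn_leq ip leqNgt ip'.
  under eq_bigr => j _ do rewrite mulrBr.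
  rewrite sumrB -addrA lerD2l lerBrDr addrC lerBlDr addrC.
  exact: hlie.
Qed.

Hypothesis p0 : (0 < p)%N.
Hypothesis psi_ge0 : forall i, (0 < i < p)%N -> 0 <= psi i 0.

Variable eps : R.
Hypotheses (eps0 : 0 < eps) (eps_le : eps <= delta 0%N * psi 0%N 0 + c).

(** Comparison with the constant vector [v] = (psi_0(0), 0, ..., 0). By [eps_le] the last row
    evaluated at [v] is at least [eps], so [psi] minus [v] stays nonnegative, and the nonnegative
    [delta j] carry the bound to all later times. *)
Lemma chain_last_derive_ge t : 0 <= t -> eps <= dpsi p.-1 t.
Proof.
move=> t0.
pose v i := if i == 0%N then psi 0%N 0 else 0.
have sum_v : \sum_(j < p) delta j * v j = delta 0%N * psi 0%N 0.
  rewrite (bigD1 (Ordinal p0)) //= big1 ?addr0 //.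
  by move=> [[|j] jp] //= _; rewrite /v /= mulr0.
have sumE s : \sum_(j < p) delta j * psi j s + c =
    \sum_(j < p) delta j * (psi j s - v j) + (delta 0%N * psi 0%N 0 + c).
  under [in RHS]eq_bigr => j _ do rewrite mulrBr.
  by rewrite sumrB sum_v addrA subrK.
have w0 i s : (i < p)%N -> 0 <= s <= t -> 0 <= psi i s - v i.
  apply: (@chain_comparison t (fun i s => psi i s - v i) dpsi).
  - move=> j u jp ut.
    apply: is_derive_eq (is_deriveB (psiP u jp) (is_derive_cst (v j) u 1)) _.
    exact: subr0.
  - move=> j u jp ut; rewrite /dpsi; case: ifP => jp'; first by rewrite subr0.
    by rewrite sumE lerDl (le_trans (ltW eps0)).
  - case=> [|j] jp; first by rewrite subrr.
    by rewrite subr0 psi_ge0.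
rewrite /dpsi prednK // ltnn sumE -[eps]add0r lerD //.
by apply: sumr_ge0 => j _; rewrite mulr_ge0 ?delta_ge0 ?w0 // t0 lexx.
Qed.

(** Induction from the end of the chain towards its start, each step integrating the bound once. *)
Lemma chain_derive_pow_le k : (k < p)%N ->
  exists2 C, 0 < C & forall t, 0 <= t -> C * t ^+ k <= dpsi (p.-1 - k) t.
Proof.
elim: k => [_|k ih kp].
  by exists eps => // t t0; rewrite expr0 mulr1 subn0; exact: chain_last_derive_ge.
have [C C0 hC] := ih (ltnW kp).
exists (C / k.+1%:R) => [|t t0]; first by rewrite divr_gt0 ?ltr0n.
have pk : (p.-1 - k < p)%N by rewrite (leq_ltn_trans (leq_subr _ _)) // prednK.
have e : (p.-1 - k.+1).+1 = (p.-1 - k)%N.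
  by rewrite subnS prednK // subn_gt0 -ltnS prednK.
rewrite /dpsi e pk.
apply: le_trans (@is_derive_pow_le R _ _ C k (fun s _ => psiP s pk) hC t t0).
by rewrite lerDr psi_ge0 // pk -e.
Qed.

(** At k = p - 1 the bound makes [psi 0] strictly increasing with growth of order t^p; the
    intermediate value theorem gives the zero and monotonicity its uniqueness. *)
Lemma chain_unique_zero : psi 0%N 0 < 0 ->
  exists! t, 0 <= t /\ psi 0%N t = 0.
Proof.
move=> neg.
have [|C C0 hC] := @chain_derive_pow_le p.-1; first by rewrite prednK.
rewrite subnn in hC.
have mono a b : 0 <= a -> a < b -> psi 0%N a < psi 0%N b.
  move=> a0 ab; apply: (@is_derive_gt0_lt R _ (dpsi 0)) => // [t _|t /andP[at_ _]].
    exact: psiP.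
  have t0 := le_lt_trans a0 at_.
  by apply: (lt_le_trans _ (hC t (ltW t0))); rewrite mulr_gt0 // exprn_gt0.
have grow := @is_derive_pow_le R _ _ C p.-1 (fun s _ => psiP s p0) hC.
rewrite prednK // in grow.
pose D := C / p%:R.
have D0 : 0 < D by rewrite divr_gt0 // ltr0n.
(* Chosen so that psi_0(0) + D b = D > 0; since b >= 1, also b <= b^p. *)
pose b := 1 - psi 0%N 0 / D.
have b1 : 1 <= b by rewrite lerDl oppr_ge0 pmulr_lle0 ?invr_gt0 // ltW.
have b0 : 0 <= b by apply: le_trans b1.
have psib : 0 <= psi 0%N b.
  apply: le_trans (grow b b0); rewrite -/D.
  apply: (@le_trans _ _ (psi 0%N 0 + D * b)).
    by rewrite /b mulrBr mulr1 mulrCA divff ?gt_eqF // mulr1 addrCA subrr addr0 ltW.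
  by rewrite lerD2l ler_wpM2l ?(ltW D0) // -[leLHS]expr1 ler_weXn2l.
have cpsi : {within `[0, b], continuous (psi 0%N)}.
  exact: (@is_derive_within_continuous _ _ _ (dpsi 0) _ _ (fun t _ => psiP t p0)).
have [|t] := IVT b0 cpsi (v := 0).
  have le0b : psi 0%N 0 <= psi 0%N b by apply: le_trans psib; exact: ltW.
  by rewrite min_l // max_r // psib ltW.
rewrite in_itv /= => /andP[t0 _] psit.
exists t; split => // s [s0 psis].
have [lt|lt|//] := ltgtP t s.
- by have := mono t s t0 lt; rewrite psit psis ltxx.
- by have := mono s t s0 lt; rewrite psit psis ltxx.
Qed.

End Chain.

(** * The bounding function mu *)

Section CompanionExponential.
Variables (R : realType) (p : nat) (delta : nat -> R) (v : 'cV[R]_p.+1).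

(** Natural indices match the sequences [psi] of the chain; [inord] is faithful for indices up to
    [p]. *)
Definition companion_flow (i : nat) (t : R) : R :=
  (expm (t *: Amat p delta) *m v) (inord i) ord0.

Lemma companion_flow0 i : companion_flow i 0 = v (inord i) ord0.
Proof. by rewrite /companion_flow expm0_mul. Qed.

Lemma is_derive_companion_flow i (t : R) : (i < p)%N ->
  is_derive t 1 (companion_flow i)
    (if (i.+1 < p)%N then companion_flow i.+1 t
     else \sum_(j < p) delta j * companion_flow j t + v ord_max ord0).
Proof.
move=> ip.
(* Row [p] of [Amat] vanishes, so the last state is constant; it enters row p - 1 with coefficient
   1. *)
have flow_max : companion_flow p t = v ord_max ord0.
  have -> : v ord_max ord0 = companion_flow p 0.
    by rewrite companion_flow0; congr (v _ _); apply: val_inj; rewrite /= inordK.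
  apply: is_derive_0_is_cst => s.
  apply: is_derive_eq (is_derive_expm_mul _ v s (inord p)) _.
  apply: big1 => j _; rewrite mxE inordK // ltnNge leqnSn /=.
  by rewrite eqn_leq [(p <= _)%N]leqNgt prednK ?leqnn ?andbF ?mul0r // (leq_ltn_trans _ ip).
apply: is_derive_eq (is_derive_expm_mul _ v t (inord i)) _.
have iE : nat_of_ord (inord i : 'I_p.+1) = i by rewrite inordK // ltnS ltnW.
case: ifP => ip'.
  rewrite (bigD1 (inord i.+1)) //= mxE iE ip' inordK ?ltnS // eqxx mul1r.
  rewrite big1 ?addr0 // => j jne; rewrite mxE iE ip'.
  case: eqP => [e|_]; last by rewrite mul0r.
  by move: jne; rewrite -val_eqE /= inordK ?ltnS // e eqxx.
have ipE : i = p.-1.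
  by apply/eqP; rewrite -eqSS prednK ?(leq_ltn_trans _ ip) // eqn_leq ip leqNgt ip'.
subst i; rewrite big_ord_recr /= mxE iE ip' eqxx ltnn mul1r -flow_max; congr (_ + _).
  apply: eq_bigr => j _; rewrite mxE iE ip' eqxx /= ltn_ord.
  by congr (_ * (_ *m _) _ _); apply: val_inj; rewrite /= inordK // ltnS ltnW.
by congr ((_ *m _) _ _); apply: val_inj; rewrite /= inordK.
Qed.

End CompanionExponential.

(** [Crow] selects component 0, which reduces [mu] to a companion flow with value and time
    rescaled. *)
Lemma muE (R : realType) (n p : nat) (F : 'rV[R]_(n + n) -> 'rV[R]_(n + n))
  (phi : 'rV[R]_(n + n) -> R) (delta : nat -> R) (alpha theta r : R)
  (x : 'rV[R]_n) (t : R) :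
  mu p F phi delta alpha theta r x t = (enorm x / r) `^ (theta + 1) *
    companion_flow delta (mu_vec p F phi delta (r / enorm x *: x)) 0
      ((enorm x / r) `^ alpha * t).
Proof.
rewrite /mu -scalemxAr -scalemxAl mxE -mulmxA; congr (_ * _).
rewrite /companion_flow mxE (bigD1 (inord 0)) //= mxE inordK // eqxx mul1r.
rewrite big1 ?addr0 // => j; rewrite mxE -val_eqE /= inordK // => /negbTE ->.
by rewrite mul0r.
Qed.

(** * Scaling and homogeneity *)

Lemma enorm_gt0 (R : realType) (n : nat) (x : 'rV[R]_n) : x != 0 -> 0 < enorm x.
Proof.
move=> x0; rewrite sqrtr_gt0 lt_neqAle sumr_ge0 ?andbT; last first.
  by move=> i _; rewrite sqr_ge0.
apply: contra x0; rewrite eq_sym psumr_eq0 => [/allP h|i _]; last by rewrite sqr_ge0.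
apply/eqP/rowP => i; rewrite mxE; apply/eqP; rewrite -sqrf_eq0.
by apply: h; rewrite mem_index_enum.
Qed.

Lemma enormZ (R : realType) (n : nat) (lam : R) (x : 'rV[R]_n) :
  0 <= lam -> enorm (lam *: x) = lam * enorm x.
Proof.
move=> lam0; rewrite /enorm -[in RHS](ger0_norm lam0) -sqrtr_sqr -sqrtrM ?sqr_ge0 //.
by rewrite mulr_sumr; congr Num.sqrt; apply: eq_bigr => i _; rewrite mxE exprMn.
Qed.

Lemma pair_stZ (R : realType) (n : nat) (lam : R) (x : 'rV[R]_n) :
  pair_st (lam *: x) 0 = lam *: pair_st x 0.
Proof. by rewrite /pair_st scale_row_mx scaler0. Qed.

(* Homogeneity of F makes t |-> s *: u (s `^ alpha * t) a solution as well. *)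
Lemma homogeneous_ode_scaling (R : realType) (n : nat)
  (F : 'rV[R]_n -> 'rV[R]_n) (alpha s : R) (u v : R -> 'rV[R]_n) (b : R) :
  smooth F -> homogeneous alpha F -> 0 < s -> 0 <= b -> v 0 = s *: u 0 ->
  (forall t, 0 <= t <= b -> is_derive t 1 v (F (v t))) ->
  (forall t, 0 <= t <= s `^ alpha * b -> is_derive t 1 u (F (u t))) ->
  v b = s *: u (s `^ alpha * b).
Proof.
move=> sF hF s0 b0 uv hv hu.
apply: (@ode_unique _ _ F v (fun t => s *: u (s `^ alpha * t)) b) => //.
  by rewrite mulr0.
move=> t /andP[t0 tb]; set k := s `^ alpha.
have k0 : 0 < k by rewrite powR_gt0.
have h1 : is_derive t 1 ( *%R k) k.
  by apply: is_derive_eq; rewrite /GRing.scale /= mulr1.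
have [du eu] : is_derive (k * t) 1 u (F (u (k * t))).
  by apply: hu; rewrite mulr_ge0 ?(ltW k0) //= ler_wpM2l // ltW.
have du' : differentiable u (k * t) by apply/derivable1_diffP.
(* The derivative is s k F(u(k t)), and s k = s^(alpha+1) is the homogeneity factor of [F]. *)
apply: is_derive_eq (is_deriveZ s (is_derive_comp_diff du' h1)) _.
rewrite deriveE // -[k in 'd _ _ k]mulr1 -[k * 1]/(k *: (1 : R)) linearZ /=.
rewrite -deriveE // eu hF // powRD; last by rewrite (gt_eqF s0) implybT.
by rewrite powRr1 ?(ltW s0) // scalerA mulrC.
Qed.

(** * The four properties of the bounding function *)

Unset Implicit Arguments.

Theorem theorem3 (R : realType) (n m : nat)
  (f : 'rV[R]_n -> 'rV[R]_m -> 'rV[R]_n) (ups : 'rV[R]_n -> 'rV[R]_m)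
  (phi : 'rV[R]_(n + n) -> R) (alpha theta : R)
  (xi : 'rV[R]_n -> R -> 'rV[R]_(n + n)) (T : 'rV[R]_n -> \bar R)
  (Z : set 'rV[R]_n) (Xi : set 'rV[R]_(n + n))
  (d : R) (p : nat) (eps : R) (delta : nat -> R) (r : R) :
  (* (i) F smooth and homogeneous of degree alpha >= 1 *)
  smooth (Fcl f ups) -> 1 <= alpha -> homogeneous alpha (Fcl f ups) ->
  (* (ii) phi smooth and homogeneous of degree theta >= 1 *)
  smooth phi -> 1 <= theta -> homogeneous theta phi ->
  (* xi(.;x) solves d/dt xi = F(xi), xi(0;x) = (x,0), on [0, T x) *)
  (forall x, (0%:E < T x)%E) ->
  (forall x, xi x 0 = pair_st x 0) ->
  (forall x t, 0 <= t -> (t%:E < T x)%E ->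
     is_derive t 1 (xi x) (Fcl f ups (xi x t))) ->
  (* (iii) *)
  (forall x, x != 0 -> phi (pair_st x 0) < 0 /\
     exists tx, 0 < tx /\ (tx%:E < T x)%E /\ phi (xi x tx) = 0) ->
  (* (iv) *)
  compact Z -> nbhs (0 : 'rV[R]_n) Z -> compact Xi -> nbhs (0 : 'rV[R]_(n + n)) Xi ->
  (forall x t, Z x -> 0 <= t -> (t%:E < T x)%E ->
     phi (xi x t) <= 0 -> Xi (xi x t)) ->
  (* (v) the origin is the only equilibrium of zeta' = f(zeta, ups(zeta)) *)
  (forall zeta, f zeta (ups zeta) = 0 <-> zeta = 0) ->
  (* the data of the theorem *)
  0 < d -> Xi `<=` [set z | enorm z < d] ->
  (1 <= p)%N -> 0 < eps ->
  (forall z, enorm z < d ->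
     lie (Fcl f ups) p phi z <=
       \sum_(i < p) delta i * lie (Fcl f ups) i phi z + delta p) ->
  (forall x, Z x -> delta 0%N * phi (pair_st x 0) + delta p >= eps) ->
  (forall i, (i <= p)%N -> 0 <= delta i) ->
  0 < r -> [set x : 'rV[R]_n | enorm x = r] `<=` Z ->
  let mu := mu p (Fcl f ups) phi delta alpha theta r in
  let tau := trig_time phi xi T in
  (* (a) *) (forall x, x != 0 -> mu x 0 < 0) /\
  (* (b) *) (forall x t, x != 0 -> 0 <= t <= tau x -> phi (xi x t) <= mu x t) /\
  (* (c) *) (forall x t lam, x != 0 -> 0 < t -> 0 < lam ->
               mu (lam *: x) t = lam `^ (theta + 1) * mu x (lam `^ alpha * t)) /\
  (* (d) *) (forall x, x != 0 -> exists! tx, 0 <= tx /\ mu x tx = 0).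
Proof.
move=> sF alpha1 hF sphi theta1 hphi T0 xi0 xiP phiP _ _ _ _ ZXi _ d0 Xid p1 eps0
  lieP epsP delta0 r0 rZ m_ tau.
(* For nonzero [x], [y x] is the point of the sphere of radius [r] on the ray through [x], and [s x]
   the factor back to [x]. *)
pose y (x : 'rV[R]_n) := r / enorm x *: x.
pose s (x : 'rV[R]_n) := enorm x / r.
have s_gt0 x : x != 0 -> 0 < s x by move=> x0; rewrite divr_gt0 ?enorm_gt0.
have xE x : x != 0 -> x = s x *: y x.
  move=> x0; rewrite scalerA mulrA divfK ?gt_eqF // divff ?scale1r //.
  by rewrite gt_eqF // enorm_gt0.
have y_neq0 x : x != 0 -> y x != 0.
  by move=> x0; rewrite scaler_eq0 negb_or x0 andbT gt_eqF // divr_gt0 // enorm_gt0.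
have Zy x : x != 0 -> Z (y x).
  move=> x0; apply: rZ; rewrite /= enormZ ?divfK // ?gt_eqF ?enorm_gt0 //.
  by rewrite ltW // divr_gt0 // enorm_gt0.
pose psi x := companion_flow delta (mu_vec p (Fcl f ups) phi delta (y x)).
have mE x t : m_ x t = s x `^ (theta + 1) * psi x 0%N (s x `^ alpha * t) by exact: muE.
have psi00 x : psi x 0%N 0 = phi (pair_st (y x) 0).
  by rewrite /psi companion_flow0 mxE inordK.
have psi_max x i : (0 < i < p)%N ->
    psi x i 0 = Num.max (lie (Fcl f ups) i phi (pair_st (y x) 0)) 0.
  move=> /andP[i0 ip]; rewrite /psi companion_flow0 mxE inordK; last exact: ltnW.
  by rewrite ip gtn_eqF.
have psiP x i (t : R) : (i < p)%N -> is_derive t 1 (psi x i)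
    (if (i.+1 < p)%N then psi x i.+1 t
     else \sum_(j < p) delta j * psi x j t + delta p).
  move=> ip; have := @is_derive_companion_flow R p delta
    (mu_vec p (Fcl f ups) phi delta (y x)) i t ip.
  by rewrite [X in _ + X]mxE /= ltnn gtn_eqF.
have delta_ge0 i : (i < p)%N -> 0 <= delta i by move=> ip; apply: delta0; exact: ltnW.
split; [|split; [|split]].
- move=> x x0; rewrite mE mulr0 psi00 pmulr_rlt0 ?powR_gt0 ?s_gt0 //.
  by case: (phiP (y x) (y_neq0 x x0)).
- move=> x t x0 /andP[t0 ttau].
  have [_ [tx [tx0 [txT phitx]]]] := phiP x x0.
  have [phiy [ty [ty0 [tyT phity]]]] := phiP (y x) (y_neq0 x x0).
  have [phix _] := phiP x x0.
  set k := s x `^ alpha.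
  have k0 : 0 < k by rewrite powR_gt0 // s_gt0.
  pose S := [set t : R | 0 < t /\ (t%:E < T x)%E /\ phi (xi x t) = 0].
  have tau_le u : S u -> tau x <= u.
    by move=> Su; apply: ge_inf Su; exists 0 => w [/ltW].
  have tautx : tau x <= tx by apply: tau_le.
  have ltT (b u : R) (z : 'rV[R]_n) : (b%:E < T z)%E -> u <= b -> (u%:E < T z)%E.
    by move=> bT ub; apply: le_lt_trans bT; rewrite lee_fin.
  have xi_scale u : 0 <= u -> (u%:E < T x)%E -> ((k * u)%:E < T (y x))%E ->
      xi x u = s x *: xi (y x) (k * u).
    move=> u0 uT kuT.
    apply: (@homogeneous_ode_scaling _ _ (Fcl f ups) alpha) => //; first exact: s_gt0.
    + by rewrite !xi0 -pair_stZ -xE.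
    + by move=> w /andP[w0 wu]; apply: xiP => //; exact: ltT wu.
    + by move=> w /andP[w0 wu]; apply: xiP => //; exact: ltT wu.
  have phi_scale u : 0 <= u -> (u%:E < T x)%E -> ((k * u)%:E < T (y x))%E ->
      phi (xi x u) = s x `^ (theta + 1) * phi (xi (y x) (k * u)).
    by move=> u0 uT kuT; rewrite xi_scale // hphi ?s_gt0.
  have c0 : 0 < s x `^ (theta + 1) by rewrite powR_gt0 // s_gt0.
  (* A positive value at [u] would force a zero of [phi] strictly between 0 and [u], before the
     infimum [tau x]. *)
  have phi_le0 u : 0 <= u -> u <= tau x -> phi (xi x u) <= 0.
    move=> u0 utau; case: (leP (phi (xi x u)) 0) => // phiu.
    have uT : (u%:E < T x)%E := ltT _ _ _ txT (le_trans utau tautx).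
    have cphi : {within `[0, u], continuous (phi \o xi x)}.
      apply: (@is_derive_within_continuous _ _ _
        (fun w => 'D_(Fcl f ups (xi x w)) phi (xi x w))) => w /andP[w0 wu].
      apply: is_derive_comp_diff; first exact: smooth_differentiable.
      by apply: xiP => //; exact: ltT wu.
    have [|w] := IVT u0 cphi (v := 0).
      have le0u : (phi \o xi x) 0 <= (phi \o xi x) u.
        by rewrite /= xi0 (le_trans (ltW phix)) // ltW.
      by rewrite min_l // max_r //= xi0 !ltW.
    rewrite in_itv /= => /andP[w0 wu] phiw.
    have wlt : w < u.
      by rewrite lt_neqAle wu andbT; apply/eqP => e; move: phiu; rewrite -e phiw ltxx.
    have wpos : 0 < w.
      rewrite lt_neqAle w0 andbT; apply/eqP => e.
      by move: phix; rewrite -phiw -e xi0 ltxx.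
    have : tau x <= w by apply: tau_le; split => //; split => //; exact: ltT (ltW wlt).
    by rewrite leNgt (lt_le_trans wlt).
  (* The zero [ty] on the sphere corresponds to the zero [ty / k] along [xi x]. The bound keeps
     rescaled times inside the existence interval of [xi (y x)]. *)
  have ktau : k * tau x <= ty.
    rewrite leNgt; apply/negP => lt.
    have u_lt : ty / k < tau x by rewrite ltr_pdivrMr // mulrC.
    have uT := ltT _ _ _ txT (le_trans (ltW u_lt) tautx).
    have kE : k * (ty / k) = ty by rewrite mulrCA divff ?mulr1 // gt_eqF.
    have u0 : 0 < ty / k by rewrite divr_gt0.
    have : tau x <= ty / k.
      apply: tau_le; split => //; split => //.
      by rewrite phi_scale ?(ltW u0) ?kE // phity mulr0.
    by rewrite leNgt u_lt.
  have kt_ty : k * t <= ty by apply: le_trans ktau; rewrite ler_wpM2l // ltW.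
  (* Time [u] on the sphere corresponds to [u / k] at [x], not after [tau x]; so [phi] is
     nonpositive there, and (iv) places the trajectory where inequality (1) holds. *)
  have xi_Xi u : 0 <= u <= k * t -> Xi (xi (y x) u).
    move=> /andP[u0 ut].
    have uT : (u%:E < T (y x))%E := ltT _ _ _ tyT (le_trans ut kt_ty).
    have kE : k * (u / k) = u by rewrite mulrCA divff ?mulr1 // gt_eqF.
    have uk0 : 0 <= u / k by rewrite divr_ge0 // ltW.
    have uk_tau : u / k <= tau x.
      by apply: le_trans ttau; rewrite ler_pdivrMr // mulrC.
    apply: ZXi => //; first exact: Zy.
    have := phi_le0 _ uk0 uk_tau.
    rewrite phi_scale ?kE ?pmulr_rle0 //.
    exact: ltT (le_trans uk_tau tautx).
  rewrite phi_scale //; last 2 first.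
  + exact: ltT (le_trans ttau tautx).
  + exact: ltT kt_ty.
  rewrite mE ler_wpM2l ?(ltW c0) //.
  apply: (@lie_le_chain R p delta delta_ge0 (delta p) (psi x) (psiP x) _
    (Fcl f ups) phi (xi (y x)) (k * t)) => //.
  + by rewrite mulr_ge0 // ltW.
  + by move=> u /andP[u0 ukt]; apply: xiP => //; exact: ltT (le_trans ukt kt_ty).
  + by move=> u ub; apply: lieP; apply: Xid; exact: xi_Xi.
  (* Component 0 starts with equality; the others are dominated through the maximum with 0. *)
  + move=> [|i] ip; first by rewrite psi00 xi0.
    by rewrite psi_max // xi0 le_max lexx.
- move=> x t lam x0 t0 lam0.
  have lx0 : lam *: x != 0 by rewrite scaler_eq0 negb_or x0 gt_eqF.
  have sE : s (lam *: x) = lam * s x by rewrite /s enormZ ?(ltW lam0) // mulrA.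
  (* Both points lie on the same ray, so only the two powers of [s] change. *)
  have yE : y (lam *: x) = y x.
    rewrite /y enormZ ?(ltW lam0) // scalerA; congr (_ *: x); field.
    by rewrite !gt_eqF // enorm_gt0.
  have sx0 := ltW (s_gt0 x x0); have l0 := ltW lam0.
  rewrite !mE sE /psi yE !(@powRM _ lam (s x)) // -mulrA.
  by congr (_ * (_ * companion_flow _ _ _ _)); ring.
- move=> x x0.
  have c0 : 0 < s x `^ (theta + 1) by rewrite powR_gt0 // s_gt0.
  have k0 : 0 < s x `^ alpha by rewrite powR_gt0 // s_gt0.
  have [|||t [[t0 psit] tuniq]] := @chain_unique_zero R p delta delta_ge0
    (delta p) (psi x) (psiP x) p1 _ eps eps0.
  + by move=> i ip; rewrite psi_max // le_max lexx orbT.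
  + by rewrite psi00; apply: epsP; exact: Zy.
  + by rewrite psi00; case: (phiP (y x) (y_neq0 x x0)).
  (* The zeros of [mu] at [x] are those of [psi x 0] after rescaling time. *)
  exists (t / s x `^ alpha); split.
    split; first by rewrite divr_ge0 // ltW.
    by rewrite mE mulrCA divff ?gt_eqF // mulr1 psit mulr0.
  move=> u [u0]; rewrite mE => /eqP; rewrite mulf_eq0 gt_eqF //= => /eqP psiu.
  have -> : t = s x `^ alpha * u.
    by apply: tuniq; split => //; rewrite mulr_ge0 // ltW.
  by rewrite mulrC mulKf // (gt_eqF k0).
Qed.
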